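(* Let $F:\mathbb{R}\to\mathcal{CC}(\mathbb{R})$ be relaxed one-sided Lipschitz with constant $l$ and $L$-Lipschitz with $l<0$ and $L<-4l$, and let $x_0\in\mathbb{R}$ and $\bar y\in\mathbb{R}$ be given. Then the sequence $\{x_n\}_{n\in\mathbb{N}}$ defined by \[x_{n+1}:=x_n+\frac{1}{2l}\big(\bar y-\mathrm{Proj}(\bar y,F(x_n))\big)\] converges to a solution $\bar x$ of the inclusion $\bar y\in F(x)$ and satisfies the estimates \[\mathrm{dist}(x_n,S_F(\bar y))\le-\frac{1}{2l}\,\kappa^{n-1}\,\mathrm{dist}(\bar y,F(x_0))\] and \[|x_n-\bar x|\le-\frac{1}{2l}\,\frac{\kappa^n}{1-\kappa}\,\mathrm{dist}(\bar y,F(x_0))\] for $n\ge1$, where $\kappa:=\max\{\frac12,|1+\frac{L}{2l}|\}$ and $S_F(\bar y):=\{x\in\mathbb{R}:\ \bar y\in F(x)\}$.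
   Context: $\mathcal{CC}(\mathbb{R})$ is the family of nonempty compact convex subsets of $\mathbb{R}$ (compact intervals). For sets $A,B$, $\mathrm{dist}(A,B):=\sup_{a\in A}\inf_{b\in B}|a-b|$ (for a point $y$, $\mathrm{dist}(y,B):=\inf_{b\in B}|y-b|$) and $\mathrm{dist}_H(A,B):=\max\{\mathrm{dist}(A,B),\mathrm{dist}(B,A)\}$. For $y\in\mathbb{R}$ and $A\in\mathcal{CC}(\mathbb{R})$, $\mathrm{Proj}(y,A)$ is the unique point of $A$ with $|y-\mathrm{Proj}(y,A)|=\mathrm{dist}(y,A)$. A map $F:\mathbb{R}\to\mathcal{CC}(\mathbb{R})$ is: $L$-Lipschitz, with $L\ge0$, if $\mathrm{dist}_H(F(x),F(x'))\le L|x-x'|$ for all $x,x'\in\mathbb{R}$; relaxed one-sided Lipschitz with constant $l\in\mathbb{R}$ ($l$-ROSL) if for any $x,x'\in\mathbb{R}$ and $y\in F(x)$ there exists $y'\in F(x')$ with $(y-y')(x-x')\le l|x-x'|^2$. *)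

(* Defs.v *)
(* The real line is an arbitrary [R : realType]. *)
From mathcomp Require Export all_boot all_order all_algebra.
From mathcomp Require Export all_classical all_reals all_analysis.

Set Implicit Arguments.
Unset Strict Implicit.
Unset Printing Implicit Defensive.

Import Order.TTheory GRing.Theory Num.Theory.
Import numFieldNormedType.Exports.

Local Open Scope classical_set_scope.
Local Open Scope ring_scope.

Definition compact_convex (R : realType) (A : set R) : Prop :=
  [/\ A !=set0, compact A & convex_set (A : set (convex_lmodType R^o))].

(* Distances are extended-real valued, so that the distance from a point to
   the empty set is +oo rather than a junk real number. *)
Definition dist_pt (R : realType) (y : R) (B : set R) : \bar R :=
  ereal_inf [set `|y - b|%:E | b in B].

Definition dist_set (R : realType) (A B : set R) : \bar R :=
  ereal_sup [set dist_pt a B | a in A].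

Definition dist_H (R : realType) (A B : set R) : \bar R :=
  maxe (dist_set A B) (dist_set B A).

(* [get] picks an element of the given set (a default point if it is empty); for
   [A] nonempty, compact and convex that set is a singleton. *)
Definition Proj (R : realType) (y : R) (A : set R) : R :=
  get [set p | A p /\ `|y - p|%:E = dist_pt y A].

Definition set_lipschitz (R : realType) (L : R) (F : R -> set R) : Prop :=
  0 <= L /\ forall x x' : R, (dist_H (F x) (F x') <= (L * `|x - x'|)%:E)%E.

Definition rosl (R : realType) (l : R) (F : R -> set R) : Prop :=
  forall x x' y : R, F x y ->
    exists2 y' : R, F x' y' & (y - y') * (x - x') <= l * `|x - x'| ^+ 2.

Definition solution_set (R : realType) (F : R -> set R) (y : R) : set R :=
  [set x | F x y].

Definition kappa (R : realType) (l L : R) : R :=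
  Num.max 2^-1 `|1 + L / (2 * l)|.

(* Main.v *)
Require Import Defs.
From mathcomp Require Import lra ring.
Set Implicit Arguments.
Unset Strict Implicit.
Unset Printing Implicit Defensive.
Import Order.TTheory GRing.Theory Num.Theory.
Import numFieldNormedType.Exports.
Local Open Scope classical_set_scope.
Local Open Scope ring_scope.

(** The proof reduces the set-valued iteration to the single-valued one.

    Write [F t = [a t, b t]].  Testing the one-sided Lipschitz condition on the
    endpoints shows that [a] and [b] decrease at rate at least [- l], and the
    Lipschitz condition that they decrease at rate at most [L]: their difference
    quotients lie in [[- L, l]] ([endpoint_slopes]).  Convex combinations of [a]
    and [b] keep this property, so through every point of the graph of [F]
    passes a selection of [F] with difference quotients in [[- L, l]]
    ([selection_through]).

    At the iterate [x n], let [g] be such a selection through the point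
    [Proj ybar (F (x n))].  The next iterate is then
    [x n + (2 * l)^-1 * (ybar - g (x n))], and two facts about the real function
    [g] settle everything.
    - This step multiplies [`|ybar - g|] by at most [kappa] ([step_residual]).
      As [g] selects from [F], the distance from [ybar] to [F (x n)] is
      therefore bounded by [kappa ^+ n] times the initial one.  The increments
      of [x] are [- (2 * l)^-1] times these distances, so [x] converges with a
      geometric error bound ([geometric_steps_cvg]); the limit solves the
      inclusion because [a] and [b] are continuous.
    - A root of [g = ybar] lies between [x n] and
      [x n + l^-1 * (ybar - g (x n))], and [x n.+1] is the midpoint of these
      two, hence within half their distance of the root ([step_near_root]).
      This gives the estimate of the distance from [x n.+1] to the solution set
      in terms of the residual at [x n], which accounts for the exponent
      [n.-1]. *)

(** * Compact intervals and projections *)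

Lemma compact_convex_itv (R : realType) (A : set R) : compact_convex A ->
  exists ab : R * R, ab.1 <= ab.2 /\ A = `[ab.1, ab.2]%classic.
Proof.
move=> [A0 cA vA].
have cid : {within A, continuous (id : R -> R)}.
  by apply: continuous_subspaceT => t; exact: cvg_id.
have [a Aa amin] := compact_EVT_min A0 cA cid.
have [b Ab bmax] := compact_EVT_max A0 cA cid.
exists (a, b) => /=; split; first exact: amin.
apply/seteqP; split=> z /=; rewrite in_itv /=.
  by move=> Az; rewrite amin ?bmax ?inE.
move=> /andP[az zb]; apply/set_mem.
have [ab|ba] := ltP a b; last by have -> : z = a by lra.
have t0 : 0 <= (b - z) / (b - a) by rewrite divr_ge0 ?subr_ge0 // ltW.
have t1 : (b - z) / (b - a) <= 1 by rewrite ler_pdivrMr ?subr_gt0 //; lra.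
have := vA a b (Itv01 t0 t1) Aa Ab.
rewrite (_ : conv _ _ _ = (z : convex_lmodType R^o)) //.
by rewrite [LHS]convRE /= /unstable.onem; field; lra.
Qed.

Lemma Proj_spec (R : realType) (y : R) (B : set R) : B !=set0 -> compact B ->
  [/\ B (Proj y B), dist_pt y B = `|y - Proj y B|%:E
    & forall q, B q -> `|y - Proj y B| <= `|y - q|].
Proof.
move=> B0 cB.
have cf : {within B, continuous (fun q : R => `|y - q|)}.
  apply: continuous_subspaceT => q.
  by apply: cvg_norm; apply: cvgB; [exact: cvg_cst|exact: cvg_id].
have [p /set_mem Bp pmin] := compact_EVT_min B0 cB cf.
have dp : dist_pt y B = `|y - p|%:E.
  apply/eqP; rewrite eq_le; apply/andP; split.
    by apply: ereal_inf_lbound; exists p.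
  by apply: le_ereal_inf_tmp => _ [b Bb <-]; rewrite lee_fin; apply/pmin/mem_set.
have ex : exists q, B q /\ `|y - q|%:E = dist_pt y B by exists p.
have [BP dP] := getPex ex.
rewrite -[get _]/(Proj y B) in BP dP.
by split=> // q Bq; rewrite -lee_fin dP dp lee_fin; exact/pmin/mem_set.
Qed.

Lemma dist_H_near (R : realType) (A B : set R) (M y : R) :
  B !=set0 -> compact B -> (dist_H A B <= M%:E)%E -> A y ->
  exists2 p, B p & `|y - p| <= M.
Proof.
move=> B0 cB dM Ay; have [BP dP _] := Proj_spec y B0 cB.
exists (Proj y B) => //; rewrite -lee_fin -dP.
apply: le_trans dM; rewrite /dist_H le_max; apply/orP; left.
by apply: ereal_sup_ubound; exists y.
Qed.

(** * Functions with bounded negative difference quotients *)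

Definition slope_between (R : realType) (l L : R) (g : R -> R) : Prop :=
  forall u v, u <= v -> - (L * (v - u)) <= g v - g u <= l * (v - u).

Lemma slope_between_opp_le (R : realType) (l L : R) (g : R -> R) :
  slope_between l L g -> - L <= l.
Proof. by move=> /(_ 0 1 ler01); rewrite subr0 !mulr1; lra. Qed.

Lemma slope_continuous (R : realType) (l L : R) (g : R -> R) :
  l < 0 -> slope_between l L g -> continuous g.
Proof.
move=> l0 sg t; apply/cvgrPdist_le => e e0.
have L0 : 0 < L by have := slope_between_opp_le sg; lra.
near=> u.
have ut : `|t - u| <= e / L.
  by near: u; apply: cvgr_dist_le; [exact: cvg_id|rewrite divr_gt0].
rewrite ler_pdivlMr // in ut.
have [tu|/ltW tu] := leP u t; have := sg _ _ tu.
  move=> /andP[lo up]; rewrite ger0_norm ?subr_ge0 // in ut.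
  by rewrite ler_norml; nra.
move=> /andP[lo up]; rewrite ler0_norm ?subr_le0 // in ut.
by rewrite ler_norml; nra.
Unshelve. all: by end_near. Qed.

(** When [L = 0] and [l < 0], [kappa l L] is [1]; the presence of some [g] with
    these slopes excludes this degenerate case, as it forces [- l <= L]. *)
Lemma kappa_lt1 (R : realType) (l L : R) (g : R -> R) :
  l < 0 -> L < - (4 * l) -> slope_between l L g -> kappa l L < 1.
Proof.
move=> l0 Ll /slope_between_opp_le lL.
rewrite /kappa gt_max invf_lt1 ?ltr1n //= ltr_norml.
have -> : L / (2 * l) = - (L / (- (2 * l))) by rewrite invrN mulrN opprK.
have p : 0 < - (2 * l) by lra.
have q : 0 < L / - (2 * l) by rewrite divr_gt0 //; lra.
have : L / - (2 * l) < 2 by rewrite ltr_pdivrMr //; lra.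
by lra.
Qed.

(** With residual [r = y - g u], the step moves [u] by [r / (2 * l)].  Along it
    [g] gains at least half of [r] and at most [- L / (2 * l)] times [r], so the
    new residual lies between [(1 + L / (2 * l)) * r] and [r / 2]. *)
Lemma step_residual (R : realType) (l L y u : R) (g : R -> R) :
  l < 0 -> slope_between l L g ->
  `|y - g (u + (2 * l)^-1 * (y - g u))| <= kappa l L * `|y - g u|.
Proof.
move=> l0 sg; set r := y - g u; set c := (2 * l)^-1.
have lc : l * c = 1 / 2 by rewrite /c; field; lra.
have c0 : c < 0 by rewrite /c invr_lt0; lra.
have k1 : 2^-1 <= kappa l L by rewrite le_max lexx.
have k2 : - kappa l L <= 1 + L * c.
  have : `|1 + L / (2 * l)| <= kappa l L by rewrite le_max lexx orbT.
  by rewrite ler_norml => /andP[].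
set v := u + c * r; have e : y - g v = r + (g u - g v) by rewrite /r; ring.
clearbody c; have [r0|/ltW r0] := leP 0 r; rewrite ler_norml e.
  have vu : v <= u by rewrite /v; nra.
  have := sg _ _ vu; rewrite (_ : u - v = - (c * r)); last by rewrite /v; ring.
  rewrite !mulrN opprK !mulrA lc => /andP[lo up].
  by rewrite (ger0_norm r0); nra.
have vu : u <= v by rewrite /v; nra.
have := sg _ _ vu; rewrite (_ : v - u = c * r); last by rewrite /v; ring.
rewrite !mulrA lc => /andP[lo up].
by rewrite (ler0_norm r0); nra.
Qed.

(** A displacement by [(y - g u) / l] is long enough for [g] to reach [y], so
    by the intermediate value theorem a root lies on the way; the step goes
    exactly half of that way. *)
Lemma step_near_root (R : realType) (l L y u : R) (g : R -> R) :
  l < 0 -> slope_between l L g ->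
  exists2 s, g s = y &
    `|u + (2 * l)^-1 * (y - g u) - s| <= - (2 * l)^-1 * `|y - g u|.
Proof.
move=> l0 sg; set r := y - g u; set c := (2 * l)^-1.
have lc : l * c = 1 / 2 by rewrite /c; field; lra.
have c0 : c < 0 by rewrite /c invr_lt0; lra.
set v := u + 2 * c * r; clearbody c.
have cg p q : {within `[p, q], continuous g}.
  by apply: continuous_subspaceT; exact: slope_continuous sg.
have [r0|/ltW r0] := leP 0 r.
  have vu : v <= u by rewrite /v; nra.
  have := sg _ _ vu.
  rewrite (_ : u - v = - (2 * c * r)); last by rewrite /v; ring.
  have -> : l * - (2 * c * r) = - (2 * (l * c) * r) by ring.
  rewrite lc => /andP[_ up].
  have [|s] := IVT vu (cg v u) (v := y).
    rewrite ge_min le_max; rewrite /r in r0 up.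
    by apply/andP; split; apply/orP; [right|left]; lra.
  rewrite in_itv /= => /andP[vs su] gs; exists s => //.
  rewrite (ger0_norm r0) ler_norml; rewrite /v in vs.
  by apply/andP; split; lra.
have vu : u <= v by rewrite /v; nra.
have := sg _ _ vu; rewrite (_ : v - u = 2 * c * r); last by rewrite /v; ring.
have -> : l * (2 * c * r) = 2 * (l * c) * r by ring.
rewrite lc => /andP[_ up].
have [|s] := IVT vu (cg u v) (v := y).
  rewrite ge_min le_max; rewrite /r in r0 up.
  by apply/andP; split; apply/orP; [right|left]; lra.
rewrite in_itv /= => /andP[vs su] gs; exists s => //.
rewrite (ler0_norm r0) ler_norml; rewrite /v in su.
by apply/andP; split; lra.
Qed.

(** * Selections of a one-sided Lipschitz interval map *)

(** The lower endpoint at [v] is a lower bound for whatever point of [F v] the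
    one-sided condition assigns to [a u], and the lower endpoint at [u] for the
    point of [F u] near [a v]; for [b] the roles of [u] and [v] are exchanged. *)
Lemma endpoint_slopes (R : realType) (F : R -> set R) (l L : R)
    (a b : R -> R) :
  (forall t, a t <= b t /\ F t = `[a t, b t]%classic) ->
  rosl l F -> set_lipschitz L F -> slope_between l L a /\ slope_between l L b.
Proof.
move=> Fab ro [_ li].
have ab t : a t <= b t by case: (Fab t).
have FE t : F t = `[a t, b t]%classic by case: (Fab t).
have Fa t : F t (a t) by rewrite FE /= in_itv /= lexx ab.
have Fb t : F t (b t) by rewrite FE /= in_itv /= lexx ab.
have near_pt u v y : F u y -> exists2 p, F v p & `|y - p| <= L * `|u - v|.
  apply: dist_H_near (li u v); first by exists (a v).
  by rewrite FE; exact: segment_compact.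
have eqVgt (u v : R) : u <= v -> u = v \/ 0 < v - u.
  by rewrite le_eqVlt subr_gt0 => /orP[/eqP|]; [left|right].
split=> u v uv; have [->|vu] := eqVgt _ _ uv.
- by rewrite !subrr !mulr0 oppr0 lexx.
- have [p] := near_pt v u (a v) (Fa v).
  rewrite FE /= in_itv /= ler_norml ger0_norm ?subr_ge0 //.
  move=> /andP[p1 p2] /andP[p3 p4].
  have [z] := ro u v (a u) (Fa u).
  rewrite FE /= in_itv /= => /andP[z1 z2].
  rewrite distrC ger0_norm ?subr_ge0 // => zz.
  by apply/andP; split; nra.
- by rewrite !subrr !mulr0 oppr0 lexx.
- have [q] := near_pt u v (b u) (Fb u).
  rewrite FE /= in_itv /= ler_norml distrC ger0_norm ?subr_ge0 //.
  move=> /andP[q1 q2] /andP[q3 q4].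
  have [z] := ro v u (b v) (Fb v).
  rewrite FE /= in_itv /= => /andP[z1 z2].
  rewrite ger0_norm ?subr_ge0 // => zz.
  by apply/andP; split; nra.
Qed.

(** If [p] divides [[a t, b t]] in some ratio, dividing every [[a u, b u]] in
    the same ratio gives a convex combination of [a] and [b]. *)
Lemma selection_through (R : realType) (F : R -> set R) (l L : R)
    (a b : R -> R) (t p : R) :
  (forall u, a u <= b u /\ F u = `[a u, b u]%classic) ->
  slope_between l L a -> slope_between l L b -> F t p ->
  exists g : R -> R, [/\ g t = p, forall u, F u (g u) & slope_between l L g].
Proof.
move=> Fab sa sb Fp.
have [th /andP[th0 th1] gt] :
    exists2 th : R, 0 <= th <= 1 & a t + th * (b t - a t) = p.
  have [ab FE] := Fab t; move: Fp; rewrite FE /= in_itv /= => /andP[ap pb].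
  have [ltab|leba] := ltP (a t) (b t); last by exists 0; lra.
  exists ((p - a t) / (b t - a t)); last by field; lra.
  by rewrite divr_ge0 ?subr_ge0 //= ler_pdivrMr ?subr_gt0 //; lra.
exists (fun u => a u + th * (b u - a u)); split=> // [u|u v uv].
  by have [ab ->] := Fab u; rewrite /= in_itv /=; apply/andP; split; nra.
have /andP[a1 a2] := sa _ _ uv; have /andP[b1 b2] := sb _ _ uv.
by apply/andP; split; nra.
Qed.

(** * Convergence *)

Lemma geometric_steps_cvg (R : realType) (x : nat -> R) (C k : R) :
  0 <= k < 1 -> (forall n, `|x n.+1 - x n| <= C * k ^+ n) ->
  exists2 z : R, x n @[n --> \oo] --> z &
    forall n, `|x n - z| <= C * (k ^+ n / (1 - k)).
Proof.
move=> /andP[k0 k1] dx.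
have cx : cvgn x.
  have : cvgn (series (telescope x)).
    apply: normed_cvg; apply: (series_le_cvg _ _ dx) => [n|n|].
    - exact: normr_ge0.
    - by apply: le_trans (dx n); exact: normr_ge0.
    - by apply: is_cvg_geometric_series; rewrite ger0_norm.
  rewrite telescopeK => cs.
  have -> : x = (fun n => x n - x 0%N) \+ cst (x 0%N).
    by apply/funext => n /=; rewrite subrK.
  by apply: is_cvgD => //; exact: is_cvg_cst.
exists (lim (x n @[n --> \oo])) => // n.
have C0 : 0 <= C by have := dx 0%N; rewrite expr0 mulr1; exact: le_trans.
have kn0 m : 0 <= k ^+ m by rewrite exprn_ge0.
have part m : `|x n - x (m + n)%N| <= C * (k ^+ n * (1 - k ^+ m) / (1 - k)).
  elim: m => [|m IH].
    by rewrite subrr normr0 expr0 subrr mulr0 mul0r mulr0.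
  rewrite addSn -(subrKA (x (m + n)%N)) (le_trans (ler_normD _ _)) //.
  rewrite (distrC _ (x (m + n).+1)); apply: (le_trans (lerD IH (dx _))).
  rewrite exprD exprS le_eqVlt; apply/orP; left; apply/eqP; field.
  by lra.
have cd : `|x n - x (m + n)%N| @[m --> \oo] --> `|x n - lim (x n @[n --> \oo])|.
  apply: cvg_norm; apply: cvgB; first exact: cvg_cst.
  by rewrite (cvg_shiftn n x).
apply: (cvgr_to_le cd); near=> m; apply: (le_trans (part m)).
rewrite ler_wpM2l // ler_wpM2r ?invr_ge0 ?subr_ge0 ?(ltW k1) //.
by rewrite ler_piMr // gerBl.
Unshelve. all: by end_near. Qed.

Theorem proposition9 (R : realType) (F : R -> set R) (l L x0 ybar : R)
    (x : nat -> R) :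
  (forall t : R, compact_convex (F t)) ->
  rosl l F ->
  set_lipschitz L F ->
  l < 0 ->
  L < - (4 * l) ->
  x 0%N = x0 ->
  (forall n : nat,
     x n.+1 = x n + (2 * l)^-1 * (ybar - Proj ybar (F (x n)))) ->
  exists xbar : R,
    [/\ solution_set F ybar xbar,
        x n @[n --> \oo] --> xbar
      & forall n : nat, (1 <= n)%N ->
          (dist_pt (x n) (solution_set F ybar) <=
             (- (2 * l)^-1 * kappa l L ^+ n.-1)%:E * dist_pt ybar (F x0))%E
          /\
          (`|x n - xbar|%:E <=
             (- (2 * l)^-1 * (kappa l L ^+ n / (1 - kappa l L)))%:E
               * dist_pt ybar (F x0))%E].
Proof.
move=> cF ro li l0 Ll x0E xS.
have [ab abP] := boolp.choice (fun t => compact_convex_itv (cF t)).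
pose a t := (ab t).1; pose b t := (ab t).2.
have FE t : F t = `[a t, b t]%classic by case: (abP t).
have [sa sb] : slope_between l L a /\ slope_between l L b.
  by apply: endpoint_slopes ro li.
have P t : [/\ F t (Proj ybar (F t)),
    dist_pt ybar (F t) = `|ybar - Proj ybar (F t)|%:E
    & forall q, F t q -> `|ybar - Proj ybar (F t)| <= `|ybar - q|].
  by have [F0 kF _] := cF t; exact: Proj_spec.
pose k := kappa l L; pose d t := `|ybar - Proj ybar (F t)|.
have k0 : 0 <= k by rewrite le_max invr_ge0 ler0n.
have k1 : k < 1 by exact: kappa_lt1 sa.
have c0 : 0 <= - (2 * l)^-1 by rewrite oppr_ge0 invr_le0; lra.
have next n : exists g : R -> R, [/\ g (x n) = Proj ybar (F (x n)),
    forall u, F u (g u) & slope_between l L g].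
  by apply: selection_through sa sb _ => //; have [] := P (x n).
have d_step n : d (x n.+1) <= k * d (x n).
  have [g [gx Fg sg]] := next n.
  have [_ _ /(_ _ (Fg (x n.+1))) /le_trans] := P (x n.+1); apply.
  by rewrite xS /d -gx; exact: step_residual.
have d_geom n : d (x n) <= k ^+ n * d x0.
  elim: n => [|n IH]; first by rewrite expr0 mul1r x0E.
  by rewrite (le_trans (d_step n)) // exprS -mulrA ler_wpM2l.
have x_step n : `|x n.+1 - x n| <= - (2 * l)^-1 * d x0 * k ^+ n.
  rewrite xS addrC addKr normrM (ler0_norm (_ : (2 * l)^-1 <= 0)); last first.
    by rewrite -oppr_ge0.
  by rewrite -mulrA (mulrC (d x0)); apply: ler_wpM2l => //; exact: d_geom.
have k01 : 0 <= k < 1 by rewrite k0.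
have [xbar xcvg xerr] := geometric_steps_cvg k01 x_step.
exists xbar; split=> //.
  (* Pass to the limit in a (x n) <= Proj ybar (F (x n)) <= b (x n): the middle
     term tends to ybar since the residuals vanish. *)
  have pcvg : Proj ybar (F (x n)) @[n --> \oo] --> ybar.
    apply/cvgrPdist_le => e e0.
    have : geometric (d x0) k @ \oo --> 0.
      by apply: cvg_geometric; rewrite ger0_norm.
    move=> /cvgr0Pnorm_le /(_ _ e0); apply: filterS => n; apply: le_trans.
    by rewrite /= (le_trans (d_geom n)) // mulrC ler_norm.
  have endcvg g : slope_between l L g -> g (x n) @[n --> \oo] --> g xbar.
    by move=> sg; apply: cvg_comp xcvg _; exact: (slope_continuous l0 sg).
  have PI n : a (x n) <= Proj ybar (F (x n)) <= b (x n).
    by have [] := P (x n); rewrite {1}FE /= in_itv.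
  rewrite /solution_set /= FE /= in_itv /=; apply/andP; split.
    apply: (ler_cvg_to (endcvg _ sa) pcvg).
    by apply: nearW => n; case/andP: (PI n).
  apply: (ler_cvg_to pcvg (endcvg _ sb)).
  by apply: nearW => n; case/andP: (PI n).
have [_ d0 _] := P x0; rewrite d0.
move=> [//|n] _; rewrite -!EFinM; split; last first.
  by rewrite lee_fin mulrAC; exact: xerr.
have [g [gx Fg sg]] := next n.
have [s gs near_s] := step_near_root ybar (x n) l0 sg.
apply: (@le_trans _ _ `|x n.+1 - s|%:E).
  by apply: ereal_inf_lbound; exists s => //; rewrite /solution_set /= -gs.
rewrite lee_fin xS -gx (le_trans near_s) //= -mulrA ler_wpM2l //.
by rewrite gx; exact: d_geom.
Qed.
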